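(* Let $G$ be a graph. Then $G$ is a hereditary $n$-convex geometry (that is, every induced subgraph $H$ of $G$, including $G$ itself, is an $n$-convex geometry with respect to its own neighbourhood convexity $n_H$) if and only if $G$ is isomorphic to $K_1$ or to $2K_1$.
   Context: All graphs are finite, simple and undirected, with non-empty vertex set (so induced subgraphs are on non-empty vertex subsets). $K_1$ is the graph with one vertex and $2K_1$ is the graph with two vertices and no edges. For a graph $G=(V,E)$ and $x\in V$, the closed neighbourhood of $x$ is $N[x]=\{x\}\cup\{y\in V:\{x,y\}\in E\}$. For $Y\subseteq V$, the common closed neighbourhood is $N[Y]=\bigcap_{y\in Y}N[y]$ if $Y\neq\varnothing$, and $N[\varnothing]=V$. The neighbourhood convexity of $G$ is the family $n_G=\{N[Y]:Y\subseteq V\}\cup\{\varnothing\}$ of subsets of $V$; it contains $\varnothing$ and $V$ and is closed under intersection. Its members are called $n$-convex sets. For $X\subseteq V$ the convex hull $[X]_{n}$ is the intersection of all $n$-convex sets containing $X$. For an $n$-convex set $K$, $\operatorname{ex}(K)=\{x\in K: K\setminus\{x\}\in n_G\}$ is the set of extreme points of $K$. $G$ is an $n$-convex geometry if $K=[\operatorname{ex}(K)]_{n}$ for every $n$-convex set $K$. *)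

(* Defs.v *)
From mathcomp Require Import all_boot.

Set Implicit Arguments.
Unset Strict Implicit.
Unset Printing Implicit Defensive.

(* The vertex set of a graph is required to be non-empty. *)
Record sgraph := SGraph {
  vertex :> finType;
  edge : rel vertex;
  edge_sym : symmetric edge;
  edge_irr : irreflexive edge;
  vertex_gt0 : 0 < #|vertex|
}.

Definition graph_iso (G H : sgraph) : Prop :=
  exists2 f : G -> H, bijective f & forall x y, edge (f x) (f y) = edge x y.

Section Induced.
Variables (G : sgraph) (U : {set G}) (U_neq0 : U != set0).

Definition induced_edge : rel {x : G | x \in U} := relpre val (@edge G).

Lemma induced_edge_sym : symmetric induced_edge.
Proof. by move=> x y; rewrite /induced_edge /= edge_sym. Qed.

Lemma induced_edge_irr : irreflexive induced_edge.
Proof. by move=> x; rewrite /induced_edge /= edge_irr. Qed.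

Lemma induced_vertex_gt0 : 0 < #|{: {x : G | x \in U}}|.
Proof. by rewrite card_sig card_gt0. Qed.

Definition induced : sgraph :=
  SGraph induced_edge_sym induced_edge_irr induced_vertex_gt0.

End Induced.

Section Edgeless.
Variable n : nat.

Definition no_edge : rel 'I_n.+1 := fun _ _ => false.

Lemma no_edge_sym : symmetric no_edge.
Proof. by []. Qed.

Lemma no_edge_irr : irreflexive no_edge.
Proof. by []. Qed.

Lemma edgeless_vertex_gt0 : 0 < #|'I_n.+1|.
Proof. by rewrite card_ord. Qed.

(* The index is shifted: [edgeless n] has n.+1 vertices. *)
Definition edgeless : sgraph :=
  SGraph no_edge_sym no_edge_irr edgeless_vertex_gt0.

End Edgeless.

Definition K1 : sgraph := edgeless 0.
Definition twoK1 : sgraph := edgeless 1.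

Section NeighbourhoodConvexity.
Variable G : sgraph.
Implicit Types (x : G) (X Y K : {set G}).

Definition closed_nbhd x : {set G} := x |: [set y | edge x y].

(* For Y = set0 the intersection is over no index, hence equal to [set: G]. *)
Definition common_closed_nbhd Y : {set G} := \bigcap_(y in Y) closed_nbhd y.

Definition n_convexity : {set {set G}} :=
  set0 |: [set common_closed_nbhd Y | Y : {set G}].

Definition n_hull X : {set G} :=
  \bigcap_(K in n_convexity | X \subset K) K.

Definition extreme_points K : {set G} :=
  [set x in K | K :\ x \in n_convexity].

Definition n_convex_geometry : Prop :=
  forall K, K \in n_convexity -> K = n_hull (extreme_points K).

End NeighbourhoodConvexity.

(* The case U = [set: G] is G itself, up to isomorphism. *)
Definition hereditary_n_convex_geometry (G : sgraph) : Prop :=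
  forall (U : {set G}) (U_neq0 : U != set0), n_convex_geometry (induced U_neq0).

(* Main.v *)
(* The whole vertex set is n-convex, so in an n-convex geometry with at least
   two vertices it has an extreme point x. As V \ x is n-convex, it is contained
   in N[y] for some y not adjacent to x. This fails for K2 and for 3K1, so a
   hereditary n-convex geometry has no edge and at most two vertices. Conversely,
   in an edgeless graph on at most two vertices every vertex set is n-convex. *)
Require Import Defs.
From mathcomp Require Import all_boot.

Lemma common_closed_nbhd1 (G : sgraph) (x : G) :
  common_closed_nbhd [set x] = closed_nbhd x.
Proof. exact: big_set1. Qed.

Lemma setT_n_convex (G : sgraph) : [set: G] \in n_convexity G.
Proof.
apply/setUP; right; apply/imsetP; exists set0 => //.
by rewrite /common_closed_nbhd big_set0.
Qed.

Lemma n_hull_set0 (G : sgraph) : n_hull (@set0 G) = set0.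
Proof.
apply/eqP; rewrite -subset0; apply: bigcap_inf.
by rewrite sub0set andbT !inE eqxx.
Qed.

Lemma n_hull_id (G : sgraph) (K : {set G}) : K \in n_convexity G -> n_hull K = K.
Proof.
move=> Kconv; apply/eqP; rewrite eqEsubset; apply/andP; split.
  by apply: bigcap_inf; rewrite Kconv subxx.
by apply/bigcapsP => L /andP[].
Qed.

Lemma n_convex_geometry_extreme (G : sgraph) : n_convex_geometry G ->
  1 < #|G| ->
  exists x y : G, [/\ x != y, ~~ edge x y &
    forall z, z != x -> (z == y) || edge y z].
Proof.
move=> geoG G_gt1; have GE := geoG _ (setT_n_convex G).
(* Without extreme points, V would be the hull of [set0], which is empty. *)
case: (set_0Vmem (extreme_points [set: G])) => [ex0 | [x]].
  by move: G_gt1; rewrite -cardsT GE ex0 n_hull_set0 cards0.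
rewrite inE => /andP[_ /setUP[|/imsetP[Y _ xE]]].
  (* If V \ x is the added member [set0], then x is the only vertex. *)
  move=> /set1P x0; move: G_gt1.
  by rewrite -cardsT (cardsD1 x) x0 cards0 inE.
have : x \notin common_closed_nbhd Y by rewrite -xE !inE eqxx.
(* As V \ x = N[Y] misses x, some factor N[y] of the intersection misses x, yet contains all of V \
   x. *)
move=> xN; have [y yY xNy] : exists2 y, y \in Y & x \notin closed_nbhd y.
  apply/exists_inP; apply: contraNT xN => /exists_inPn NxY.
  by apply/bigcapP => y /NxY; rewrite negbK.
exists x, y; move: xNy; rewrite !inE negb_or edge_sym => /andP[-> ->].
split=> // z zx; have : z \in [set: G] :\ x by rewrite !inE zx.
by rewrite xE => /bigcapP/(_ y yY); rewrite !inE.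
Qed.

(** Moves the extreme-point property from [induced U_neq0] back to vertices of [G], so that a choice
    of [U] can be exploited without the subtype. *)
Lemma hereditary_extreme (G : sgraph) (U : {set G}) :
  hereditary_n_convex_geometry G -> 1 < #|U| ->
  exists x y, [/\ x \in U, y \in U, x != y, ~~ edge x y &
    forall z, z \in U -> z != x -> (z == y) || edge y z].
Proof.
move=> herG U_gt1; have U_neq0 : U != set0 by rewrite -card_gt0 ltnW.
have := @n_convex_geometry_extreme (induced U_neq0) (herG U U_neq0).
rewrite card_sig => /(_ U_gt1)[[x xU] [[y yU] [xy Exy yz]]].
by exists x, y; split=> // z zU zx; apply: (yz (exist _ z zU)).
Qed.

Lemma hereditary_edgeless (G : sgraph) : hereditary_n_convex_geometry G ->
  forall x y : G, edge x y = false.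
Proof.
move=> herG x y; apply/negP => Exy.
have xy : x != y by apply: contraTneq Exy => ->; rewrite edge_irr.
(* Two distinct members of {x, y} must be x and y in some order, hence adjacent. *)
have [|u [v]] := @hereditary_extreme G [set x; y] herG; first by rewrite cards2 xy.
case=> /set2P[] -> /set2P[] ->; rewrite ?eqxx ?Exy //.
by rewrite edge_sym Exy.
Qed.

Lemma hereditary_card (G : sgraph) : hereditary_n_convex_geometry G -> #|G| <= 2.
Proof.
move=> herG; rewrite leqNgt; apply/negP => G_gt2.
(* No triple has to be selected: without edges N[y] = {y}, so already in the whole graph V \ x lies
   in {y}. *)
have [|x [y [_ _ _ _ yz]]] := @hereditary_extreme G [set: G] herG.
  by rewrite cardsT ltnW.
have : [set: G] \subset [set x; y].
  apply/subsetP => z _; rewrite !inE; have [//|zx] := eqVneq z x.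
  by have := yz z (in_setT z) zx; rewrite hereditary_edgeless ?orbF.
move/subset_leq_card; rewrite cardsT cards2 => /(leq_trans G_gt2).
by case: (x != y).
Qed.

Lemma edgeless_iso (G : sgraph) n : (forall x y : G, edge x y = false) ->
  #|G| = n.+1 -> graph_iso G (edgeless n).
Proof.
move=> E0 cardG; exists (cast_ord cardG \o enum_rank).
  apply: bij_comp (enum_rank_bij _).
  by exists (cast_ord (esym cardG)); [apply: cast_ordK | apply: cast_ordKV].
by move=> x y; rewrite E0.
Qed.

Lemma iso_edgeless (G : sgraph) n : graph_iso G (edgeless n) ->
  (forall x y : G, edge x y = false) /\ #|G| = n.+1.
Proof.
case=> f bij_f fE; split=> [x y|]; first by rewrite -fE.
by rewrite (bij_eq_card bij_f) card_ord.
Qed.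

(** By size: [set0] is n-convex by definition, a singleton {x} is N[x], and two vertices exhaust
    V. *)
Lemma small_edgeless_n_convex (G : sgraph) (K : {set G}) :
  (forall x y : G, edge x y = false) -> #|G| <= 2 -> K \in n_convexity G.
Proof.
move=> E0 G_le2; have [->|K_neq0] := eqVneq K set0; first by rewrite !inE eqxx.
have [K_gt1 | K_le1] := ltnP 1 #|K|.
  suff -> : K = [set: G] by apply: setT_n_convex.
  by apply/eqP; rewrite eqEcard subsetT cardsT (leq_trans G_le2).
have /cards1P[x ->] : #|K| == 1 by rewrite eqn_leq K_le1 card_gt0.
apply/setUP; right; apply/imsetP; exists [set x] => //.
by rewrite common_closed_nbhd1; apply/setP => y; rewrite !inE E0 orbF.
Qed.

Lemma small_edgeless_hereditary (G : sgraph) :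
  (forall x y : G, edge x y = false) -> #|G| <= 2 ->
  hereditary_n_convex_geometry G.
Proof.
move=> E0 G_le2 U U_neq0 K _.
have conv (L : {set induced U_neq0}) : L \in n_convexity (induced U_neq0).
  apply: small_edgeless_n_convex => [x y|]; first exact: E0.
  by rewrite card_sig (leq_trans (max_card _)).
(* Since each K \ x is n-convex too, every point of K is extreme. *)
suff -> : extreme_points K = K by rewrite n_hull_id.
by apply/setP => x; rewrite inE conv andbT.
Qed.

Theorem theorem17 (G : sgraph) :
  hereditary_n_convex_geometry G <-> graph_iso G K1 \/ graph_iso G twoK1.
Proof.
split=> [herG | [] /iso_edgeless[E0 cardG]]; last 2 first.
- by apply: small_edgeless_hereditary; rewrite ?cardG.
- by apply: small_edgeless_hereditary; rewrite ?cardG.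
have E0 := hereditary_edgeless G herG; have := hereditary_card G herG.
rewrite leq_eqVlt ltnS => /orP[/eqP G2 | G_le1].
  by right; apply: edgeless_iso.
(* Non-emptiness of the vertex set rules out zero vertices. *)
by left; apply: edgeless_iso => //; apply/eqP; rewrite eqn_leq G_le1 vertex_gt0.
Qed.
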